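(* Let $(X,\mathcal A)$ be a measurable space and let $\mathcal P(X)$ be the set of probability measures on it. Then $(\mathcal P(X)\times\mathcal P(X),\operatorname{KL})$ is an NNCC space, where $\operatorname{KL}$ is the relative entropy (Kullback--Leibler divergence).
   Context: $\operatorname{KL}(\mu,\nu)=\int_XF\big(\frac{d\mu}{d\nu}\big)\,d\nu$ if $\mu\ll\nu$ and $+\infty$ otherwise, with $F(t)=t\log(t)-t+1$. For arbitrary sets $A,B$ and a function $c\colon A\times B\to[-\infty,+\infty]$: given a path $\mathrm x\colon[0,1]\to A$ (an arbitrary function; no continuity is required) and $\bar y\in B$, the pair $(\mathrm x,\bar y)$ is a variational c-segment on $(A\times B,c)$ if $c(\mathrm x(s),\bar y)$ is finite for all $s\in[0,1]$ and, for all $s\in(0,1)$ and $y\in B$, $$c(\mathrm x(s),\bar y)-c(\mathrm x(s),y)\le (1-s)[c(\mathrm x(0),\bar y)-c(\mathrm x(0),y)]+s[c(\mathrm x(1),\bar y)-c(\mathrm x(1),y)],$$ with the usual arithmetic in $[-\infty,+\infty]$ and the rule $(+\infty)+(-\infty)=(-\infty)+(+\infty)=+\infty$ in the right-hand side. $(A\times B,c)$ is an NNCC space if for every $(x_0,x_1,\bar y)\in A\times A\times B$ such that $c(x_0,\bar y)$ and $c(x_1,\bar y)$ are finite, there exists a variational c-segment $(\mathrm x,\bar y)$ with $\mathrm x(0)=x_0$, $\mathrm x(1)=x_1$. Here $A=B=\mathcal P(X)$ and $c(\mu,\nu)=\operatorname{KL}(\mu,\nu)$, the first argument playing the role of the moving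 variable. *)

(* Defs.v *)
From HB Require Import structures.
From mathcomp Require Import all_boot all_order all_algebra.
From mathcomp Require Import all_classical all_reals all_analysis.

Set Implicit Arguments.
Unset Strict Implicit.
Unset Printing Implicit Defensive.

Import Order.TTheory GRing.Theory Num.Theory.

Local Open Scope ring_scope.

(* A path [0,1] -> A is a function on all of R whose values outside [0,1] are
   never used. In ereal_dual_scope (%dE), (+oo) + (-oo) = (-oo) + (+oo) = +oo,
   the required convention on the right-hand side; when c (x s) ybar is finite
   the left-hand side is not an indeterminate form. *)
Definition variational_c_segment (R : realType) (A B : Type)
    (c : A -> B -> \bar R) (x : R -> A) (ybar : B) : Prop :=
  (forall s : R, 0 <= s <= 1 -> c (x s) ybar \is a fin_num) /\
  (forall (s : R) (y : B), 0 < s < 1 ->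
     (c (x s) ybar - c (x s) y <=
      ((1 - s)%:E * (c (x 0%R) ybar - c (x 0%R) y) +
       s%:E * (c (x 1%R) ybar - c (x 1%R) y))%dE)%E).

Definition NNCC_space (R : realType) (A B : Type) (c : A -> B -> \bar R) :
    Prop :=
  forall (x0 x1 : A) (ybar : B),
    c x0 ybar \is a fin_num -> c x1 ybar \is a fin_num ->
    exists x : R -> A,
      [/\ variational_c_segment c x ybar, x 0 = x0 & x 1 = x1].

(* Since ln 0 = 0 in the library, entropy_fun 0 = 1, i.e. 0 log 0 = 0. *)
Definition entropy_fun (R : realType) (t : R) : R := t * ln t - t + 1.

(* When mu `<< nu, the library's Radon-Nikodym derivative is finite everywhere,
   so that fine loses no information. *)
Definition KL (R : realType) (d : measure_display) (X : measurableType d)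
    (mu nu : probability X R) : \bar R :=
  if `[< mu `<< nu >] then
    (\int[nu]_x (entropy_fun
       (fine (Radon_Nikodym (charge_of_finite_measure mu) nu x)))%:E)%E
  else +oo%E.

(* Main.v *)
Require Import Defs.
From mathcomp Require Import all_boot all_order all_algebra.
From mathcomp Require Import all_classical all_reals all_analysis.
From mathcomp Require Import measurable_realfun ring lra.

(** The segment joining mu0 to mu1 is the linear one, m_s = (1-s) mu0 + s mu1,
    whatever the base point nu. Formally KL(mu,nu) - KL(mu,sigma) is the
    integral of log(dsigma/dnu) against mu, which is affine in mu, so the
    inequality to be proved is an equality as long as everything is finite.

    To make this rigorous when some divergences are infinite, one uses the
    compensation identity ([compensation_identity]): for every sigma,

      (1-s) KL(mu0,sigma) + s KL(mu1,sigma) = KL(m_s,sigma) + J,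
      where J = (1-s) KL(mu0,m_s) + s KL(mu1,m_s),

    as an identity between elements of [0,+oo]. The point is that the defect J
    does not depend on sigma. Taking sigma = nu shows that KL(m_s,nu) and J are
    finite when KL(mu0,nu) and KL(mu1,nu) are. For another sigma, either
    KL(m_s,sigma) = +oo and the left-hand side of the required inequality is
    -oo, or all the terms are finite and subtracting the two instances of the
    identity gives equality ([interpolation_of_equal_defects]).

    The compensation identity rests on the Jensen gap of F(t) = t log t - t + 1,

      G(a,b) = (1-s) F(a) + s F(b) - F((1-s) a + s b).

    If f0 and f1 are densities of mu0 and mu1 with respect to sigma, then
    (1-s) f0 + s f1 is a density of m_s, so that the defect is the integral of
    G(f0,f1) with respect to sigma ([KL_mixture_density]). All the integrands
    are nonnegative, hence no integrability has to be checked. The gap G is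
    positively homogeneous ([jensen_gap_homogeneous]); writing f_i = h_i f with
    h_i a density of mu_i with respect to m_s and f a density of m_s with
    respect to sigma, the defect becomes the integral of G(h0,h1) with respect
    to m_s, from which sigma has disappeared. *)

Import Order.TTheory GRing.Theory Num.Theory.

Local Open Scope classical_set_scope.
Local Open Scope ring_scope.

(** * The entropy function and its Jensen gap *)

Section entropy_fun_theory.
Context {R : realType}.
Implicit Types s t a b c : R.

(** This is log u <= u - 1 at u = 1/t, multiplied by t. *)
Lemma entropy_fun_ge0 t : 0 <= t -> 0 <= entropy_fun t.
Proof.
rewrite le_eqVlt => /predU1P[<-|t0]; rewrite /entropy_fun.
  by rewrite mul0r subr0 add0r.
have : ln (1 + (t^-1 - 1)) <= t^-1 - 1.
  by apply: le_ln1Dx; rewrite ltrBrDr addNr invr_gt0.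
rewrite addrC subrK lnV ?posrE// => /(ler_wpM2l (ltW t0)).
by rewrite mulrBr mulfV ?gt_eqF//; lra.
Qed.

Lemma measurable_entropy_fun (d : measure_display) (X : measurableType d)
    (f : X -> R) :
  measurable_fun setT f -> measurable_fun setT (fun x => entropy_fun (f x)).
Proof.
move=> mf; rewrite /entropy_fun.
apply: measurable_funD => //; apply: measurable_funB => //.
by apply: measurable_funM => //; exact: measurableT_comp.
Qed.

Definition jensen_gap s a b : R :=
  (1 - s) * entropy_fun a + s * entropy_fun b
  - entropy_fun ((1 - s) * a + s * b).

(* The convention ln 0 = 0 makes the product rule hold up to the boundary. *)
Let mul_ln c t : 0 <= c -> 0 <= t ->
  (t * c) * ln (t * c) = c * (t * ln t) + t * (c * ln c).
Proof.
rewrite le_eqVlt => /predU1P[<-|c0]; first by rewrite mulr0 !mul0r mulr0 addr0.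
rewrite le_eqVlt => /predU1P[<-|t0]; first by rewrite !(mul0r, mulr0) addr0.
by rewrite lnM ?posrE//; ring.
Qed.

(** Replacing (a, b) by (a c, b c) changes a log a by a c log c, besides the
    factor c; as this is linear in a it cancels in the gap, like the affine part
    -t + 1 of the entropy function. *)
Lemma jensen_gap_homogeneous s c a b :
  0 <= s <= 1 -> 0 <= c -> 0 <= a -> 0 <= b ->
  jensen_gap s (a * c) (b * c) = c * jensen_gap s a b.
Proof.
move=> /andP[s0 s1] c0 a0 b0; rewrite /jensen_gap /entropy_fun.
have -> : (1 - s) * (a * c) + s * (b * c) = ((1 - s) * a + s * b) * c by ring.
rewrite !mul_ln//; first by ring.
by rewrite addr_ge0 ?mulr_ge0// subr_ge0.
Qed.

(** Convexity of the entropy function. By homogeneity one may assume, unless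
    a = b = 0, that the barycenter is 1, where the entropy function vanishes, so
    that nothing is subtracted from a nonnegative quantity. *)
Lemma jensen_gap_ge0 s a b : 0 < s < 1 -> 0 <= a -> 0 <= b ->
  0 <= jensen_gap s a b.
Proof.
move=> /andP[s0 s1] a0 b0; set k := (1 - s) * a + s * b.
have os0 : 0 < 1 - s by rewrite subr_gt0.
have : 0 <= k by rewrite addr_ge0 ?mulr_ge0// ltW.
rewrite le_eqVlt => /predU1P[k0|k0].
  have /eqP := esym k0.
  rewrite paddr_eq0 ?mulr_ge0 ?(ltW s0) ?(ltW os0)// !mulf_eq0.
  rewrite (gt_eqF s0) (gt_eqF os0) /=.
  move=> /andP[/eqP -> /eqP ->].
  by rewrite /jensen_gap /entropy_fun !(mul0r, mulr0, addr0, subr0); lra.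
rewrite -[a](divfK (lt0r_neq0 k0)) -[b](divfK (lt0r_neq0 k0)).
rewrite jensen_gap_homogeneous ?divr_ge0 ?(ltW k0) ?(ltW s0) ?(ltW s1)//.
rewrite mulr_ge0 ?(ltW k0)// /jensen_gap.
have -> : (1 - s) * (a / k) + s * (b / k) = 1.
  by rewrite !mulrA -mulrDl divff// gt_eqF.
rewrite [entropy_fun 1]/entropy_fun ln1 mulr0 add0r addNr subr0.
by rewrite addr_ge0// mulr_ge0 ?entropy_fun_ge0 ?divr_ge0// ltW.
Qed.

Lemma measurable_jensen_gap s (d : measure_display) (X : measurableType d)
    (f g : X -> R) : measurable_fun setT f -> measurable_fun setT g ->
  measurable_fun setT (fun x => jensen_gap s (f x) (g x)).
Proof.
move=> mf mg; rewrite /jensen_gap.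
apply: measurable_funB; first apply: measurable_funD.
- by apply: measurable_funM => //; exact: measurable_entropy_fun.
- by apply: measurable_funM => //; exact: measurable_entropy_fun.
- apply: measurable_entropy_fun; apply: measurable_funD.
  + exact: measurable_funM.
  + exact: measurable_funM.
Qed.

End entropy_fun_theory.

(** * Densities and relative entropy *)

Section density.
Local Open Scope ereal_scope.
Context {R : realType} {d : measure_display} {X : measurableType d}.
Implicit Types (mu nu m : probability X R) (f g h : X -> R).

(** Everywhere finite and nonnegative versions of the Radon-Nikodym derivative:
    this allows pointwise manipulations without exceptional sets. *)
Definition is_density mu nu f :=
  [/\ measurable_fun setT f, forall x, (0 <= f x)%R &
      forall A, measurable A -> mu A = \int[nu]_(x in A) (f x)%:E].

Lemma density_exists {mu nu} : mu `<< nu -> exists f, is_density mu nu f.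
Proof.
move=> munu; pose f := Radon_Nikodym_SigmaFinite.f mu nu.
have ffin : forall x, f x \is a fin_num.
  by move=> x; exact: Radon_Nikodym_SigmaFinite.f_fin_num.
exists (fine \o f); split.
- apply: measurableT_comp => //.
  exact: measurable_int (Radon_Nikodym_SigmaFinite.f_integrable munu).
- by move=> x; rewrite fine_ge0//; exact: Radon_Nikodym_SigmaFinite.f_ge0.
- move=> A mA; under eq_integral do rewrite /= fineK//.
  exact: Radon_Nikodym_SigmaFinite.f_integral.
Qed.

Lemma density_dominates {mu nu f} : is_density mu nu f -> mu `<< nu.
Proof.
move=> [mf f0 fE]; apply/null_content_dominatesP => A mA nuA.
by rewrite fE// null_set_integral//; exact/measurable_EFinP/measurable_funTS.
Qed.

Lemma density_integrable {mu nu f} :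
  is_density mu nu f -> nu.-integrable setT (EFin \o f).
Proof.
move=> [mf f0 fE]; apply/integrableP; split; first exact/measurable_EFinP.
under eq_integral do rewrite /= ger0_norm//.
by rewrite -fE// probability_setT ltry.
Qed.

Lemma density_ae_unique {mu nu f} {g : X -> \bar R} :
  is_density mu nu f -> measurable_fun setT g ->
  (forall A, measurable A -> mu A = \int[nu]_(x in A) g x) ->
  ae_eq nu setT (EFin \o f) g.
Proof.
move=> fd mg gE; apply: integral_ae_eq => //.
  exact: density_integrable fd.
by move=> A _ mA; rewrite -gE//; case: fd => _ _ ->.
Qed.

(** This is known for one particular version of the Radon-Nikodym derivative,
    and any density agrees with it almost everywhere. *)
Lemma density_change_of_variables {mu nu f g} {A : set X} :
  is_density mu nu f -> measurable A ->
  measurable_fun setT g -> (forall x, (0 <= g x)%R) ->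
  \int[mu]_(x in A) (g x)%:E = \int[nu]_(x in A) (g x * f x)%:E.
Proof.
move=> fd mA mg g0; have munu := density_dominates fd.
have rnm : measurable_fun setT (Radon_Nikodym_SigmaFinite.f mu nu).
  exact: measurable_int (Radon_Nikodym_SigmaFinite.f_integrable munu).
rewrite -(@Radon_Nikodym_SigmaFinite.change_of_variables _ _ _ _ _ munu
  (EFin \o g))//; last exact/measurable_EFinP/measurable_funTS.
have [mf f0 _] := fd.
apply: ge0_ae_eq_integral => //.
- apply: measurable_funTS; apply: emeasurable_funM => //.
  exact/measurable_EFinP.
- by apply/measurable_EFinP/measurable_funTS/measurable_funM.
- move=> x _; rewrite mule_ge0 ?lee_fin//.
  exact: Radon_Nikodym_SigmaFinite.f_ge0.
- by move=> x _; rewrite lee_fin mulr_ge0.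
- have := density_ae_unique fd rnm (Radon_Nikodym_SigmaFinite.f_integral munu).
  apply: filterS => x /= /(_ I) <- _.
  by rewrite EFinM.
Qed.

(** The relative entropy may be computed with any density, since two densities
    agree almost everywhere. *)
Lemma KL_density {mu nu f} : is_density mu nu f ->
  KL mu nu = \int[nu]_x (entropy_fun (f x))%:E.
Proof.
move=> fd; have munu := density_dominates fd; rewrite /KL asboolT//.
set rn := Radon_Nikodym _ _.
have mrn : measurable_fun setT rn.
  by apply: measurable_int; exact: Radon_Nikodym_integrable.
have [mf f0 _] := fd.
apply/ae_eq_integral => //.
- by apply/measurable_EFinP/measurable_entropy_fun/measurableT_comp.
- exact/measurable_EFinP/measurable_entropy_fun.
- have := density_ae_unique fd mrn
      (fun A => @Radon_Nikodym_integral _ _ _ (charge_of_finite_measure mu) nu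
        A munu).
  by apply: filterS => x /= /(_ I) <-.
Qed.

Lemma KL_ge0 mu nu : 0 <= KL mu nu.
Proof.
have [/density_exists[f fd]|munu] := pselect (mu `<< nu).
  rewrite (KL_density fd) integral_ge0// => x _.
  by rewrite lee_fin entropy_fun_ge0//; case: fd.
by rewrite /KL asboolF.
Qed.

Lemma KL_self mu : KL mu mu = 0.
Proof.
have mumu : is_density mu mu (cst 1%R).
  by split=> // A mA; rewrite -[LHS]mul1e -integral_cst.
rewrite (KL_density mumu).
by rewrite integral0_eq// => x _; rewrite /entropy_fun ln1 mulr0 sub0r addNr.
Qed.

Lemma density_trans {mu m nu h f} : is_density mu m h -> is_density m nu f ->
  is_density mu nu (fun x => h x * f x)%R.
Proof.
move=> [mh h0 hE] fd; have [mf f0 _] := fd; split.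
- exact: measurable_funM.
- by move=> x; rewrite mulr_ge0.
- by move=> A mA; rewrite hE// (density_change_of_variables fd).
Qed.

End density.

Lemma ge0_integral_lincomb {R : realType} {d : measure_display}
    {X : measurableType d} (mu : {measure set X -> \bar R}) (A : set X)
    (a b : R) (f g : X -> R) :
  0 <= a -> 0 <= b -> measurable A ->
  measurable_fun A f -> measurable_fun A g ->
  (forall x, 0 <= f x) -> (forall x, 0 <= g x) ->
  (\int[mu]_(x in A) (a * f x + b * g x)%:E =
   a%:E * \int[mu]_(x in A) (f x)%:E + b%:E * \int[mu]_(x in A) (g x)%:E)%E.
Proof.
move=> a0 b0 mA mf mg f0 g0.
under eq_integral do rewrite EFinD !EFinM.
rewrite ge0_integralD//; last 4 first.
- by move=> x _; rewrite -EFinM lee_fin mulr_ge0.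
- by apply/measurable_EFinP/measurable_funM.
- by move=> x _; rewrite -EFinM lee_fin mulr_ge0.
- by apply/measurable_EFinP/measurable_funM.
rewrite !ge0_integralZl// => *; rewrite ?lee_fin//; exact/measurable_EFinP.
Qed.

(** * Mixtures and the compensation identity *)

Section mixture.
Local Open Scope ereal_scope.
Context {R : realType} {d : measure_display} {X : measurableType d}.
Variables (s : R) (s01 : (0 < s < 1)%R).
Variables (mu0 mu1 m : probability X R).

(** A relation rather than an operation: only the values on measurable sets
    matter, and any probability measure with these values will do. *)
Definition is_mixture :=
  forall A, measurable A -> m A = (1 - s)%:E * mu0 A + s%:E * mu1 A.

Hypothesis mE : is_mixture.

Let s0 : (0 < s)%R. Proof. by case/andP: s01. Qed.
Let os0 : (0 < 1 - s)%R. Proof. by rewrite subr_gt0; case/andP: s01. Qed.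

Lemma mixture_density {nu : probability X R} {f0 f1 : X -> R} :
  is_density mu0 nu f0 -> is_density mu1 nu f1 ->
  is_density m nu (fun x => (1 - s) * f0 x + s * f1 x)%R.
Proof.
move=> [mf0 f00 f0E] [mf1 f10 f1E]; split.
- by apply: measurable_funD; apply: measurable_funM.
- by move=> x; rewrite addr_ge0// mulr_ge0// ltW.
- move=> A mA; rewrite mE// f0E// f1E// ge0_integral_lincomb//.
  + exact: ltW.
  + exact: ltW.
  + exact: measurable_funTS.
  + exact: measurable_funTS.
Qed.

Lemma mixture_dominatesP (nu : probability X R) :
  m `<< nu <-> mu0 `<< nu /\ mu1 `<< nu.
Proof.
split=> [mnu|[/density_exists[f0 fd0] /density_exists[f1 fd1]]]; last first.
  exact: density_dominates (mixture_density fd0 fd1).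
suff H : forall A, measurable A -> nu A = 0 -> mu0 A = 0 /\ mu1 A = 0.
  by split; apply/null_content_dominatesP => A mA /(H _ mA)[].
move=> A mA nuA.
have : m A = 0 by exact: (null_content_dominatesP _ _).1 mnu _ mA nuA.
rewrite mE// => /eqP.
rewrite padde_eq0 ?mule_ge0 ?lee_fin ?(ltW s0) ?(ltW os0)//.
by rewrite !mule_eq0 !eqe (gt_eqF s0) (gt_eqF os0) /= => /andP[/eqP + /eqP].
Qed.

(** The gap was defined so that this holds under the integral sign; as both
    terms on the right are nonnegative, the identity survives integration even
    when the values are infinite. *)
Lemma KL_mixture_density {nu : probability X R} {f0 f1 : X -> R} :
  is_density mu0 nu f0 -> is_density mu1 nu f1 ->
  (1 - s)%:E * KL mu0 nu + s%:E * KL mu1 nu =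
  KL m nu + \int[nu]_x (jensen_gap s (f0 x) (f1 x))%:E.
Proof.
move=> fd0 fd1; have fd := mixture_density fd0 fd1.
have [mf0 f00 _] := fd0; have [mf1 f10 _] := fd1; have [mf f_ge0 _] := fd.
rewrite (KL_density fd0) (KL_density fd1) (KL_density fd).
have mF0 := measurable_entropy_fun _ _ _ mf0.
have mF1 := measurable_entropy_fun _ _ _ mf1.
have mF := measurable_entropy_fun _ _ _ mf.
have F0 := fun x => entropy_fun_ge0 _ (f00 x).
have F1 := fun x => entropy_fun_ge0 _ (f10 x).
have F := fun x => entropy_fun_ge0 _ (f_ge0 x).
rewrite -ge0_integral_lincomb ?ltW// -ge0_integralD//.
- by apply: eq_integral => x _; rewrite -EFinD /jensen_gap [in RHS]addrC subrK.
- by move=> x _; rewrite lee_fin.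
- exact/measurable_EFinP.
- by move=> x _; rewrite lee_fin jensen_gap_ge0.
- exact/measurable_EFinP/measurable_jensen_gap.
Qed.

(** When m is dominated by nu, write the densities of mu0 and mu1 with respect
    to nu as h0 f and h1 f, where f is the density of m. By homogeneity the
    integral of the gap with respect to nu is its integral at (h0, h1) with
    respect to m; the case nu = m of [KL_mixture_density] identifies the latter,
    because KL(m,m) = 0. Otherwise both sides are +oo. *)
Lemma compensation_identity (nu : probability X R) :
  (1 - s)%:E * KL mu0 nu + s%:E * KL mu1 nu =
  KL m nu + ((1 - s)%:E * KL mu0 m + s%:E * KL mu1 m).
Proof.
have KLy (mu : probability X R) : ~ mu `<< nu -> KL mu nu = +oo.
  by move=> ?; rewrite /KL asboolF.
have wKL_ge0 c (mu nu' : probability X R) : (0 < c)%R -> 0 <= c%:E * KL mu nu'.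
  by move=> c0; rewrite mule_ge0 ?lee_fin ?KL_ge0 ?ltW.
have [mnu|mnu] := pselect (m `<< nu); last first.
  rewrite (KLy _ mnu) addye; last first.
    by rewrite gt_eqF// (lt_le_trans ltNy0)// adde_ge0// wKL_ge0.
  have [mu0nu|/KLy ->] := pselect (mu0 `<< nu); last first.
    by rewrite gt0_muley// addye// gt_eqF// (lt_le_trans ltNy0)// wKL_ge0.
  have [mu1nu|/KLy ->] := pselect (mu1 `<< nu); last first.
    by rewrite gt0_muley// addey// gt_eqF// (lt_le_trans ltNy0)// wKL_ge0.
  by case: mnu; apply/mixture_dominatesP.
have [/density_exists[h0 hd0] /density_exists[h1 hd1]] :=
  (mixture_dominatesP m).1 (fun _ mN => mN).
have [f fd] := density_exists mnu.
rewrite (KL_mixture_density (density_trans hd0 fd) (density_trans hd1 fd)).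
rewrite (KL_mixture_density hd0 hd1) KL_self add0e; congr (_ + _).
have [mh0 h00 _] := hd0; have [mh1 h10 _] := hd1; have [mf f0 _] := fd.
rewrite (density_change_of_variables fd)//; last 2 first.
- exact: measurable_jensen_gap.
- by move=> x; rewrite jensen_gap_ge0.
apply: eq_integral => x _; rewrite jensen_gap_homogeneous 1?mulrC//.
by case/andP: s01 => ? ?; rewrite !ltW.
Qed.

End mixture.

Lemma mixture_exists {R : realType} {d : measure_display}
    {X : measurableType d} (mu0 mu1 : probability X R) (s : R) :
  0 < s < 1 -> exists m, is_mixture s mu0 mu1 m.
Proof.
move=> /andP[s0 s1].
have os0 : 0 <= 1 - s by rewrite subr_ge0 ltW.
pose mix : {measure set X -> \bar R} :=
  measure_add (mscale (NngNum os0) mu0) (mscale (NngNum (ltW s0)) mu1).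
have mixE A : mix A = ((1 - s)%:E * mu0 A + s%:E * mu1 A)%E.
  exact: measure_addE.
have mix1 : mix setT = 1%E.
  rewrite mixE.
  rewrite [mu0 _]probability_setT [mu1 _]probability_setT !mule1.
  by rewrite -EFinD subrK.
(* The normalization is trivial, as mix has total mass 1. Its role is to provide
   the structure of a probability measure; mu0 is only a default value. *)
exists (mnormalize mix mu0) => A mA.
rewrite -mixE; change (mnormalize mix mu0 A = mix A).
by rewrite /mnormalize mix1 onee_eq0/= invr1 mule1.
Qed.

(** * Linear segments are variational segments *)

(** If two functions have the same finite defect J from affineness at s, their
    difference is affine at s. When b is infinite the left-hand side is -oo;
    when b is finite so are b0 and b1, because s and 1 - s are positive. *)
Lemma interpolation_of_equal_defects {R : realType} {s : R}
    {a0 a1 a b0 b1 b J : \bar R} : 0 < s < 1 ->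
  a0 \is a fin_num -> a1 \is a fin_num -> a \is a fin_num ->
  J \is a fin_num -> (0 <= b)%E ->
  ((1 - s)%:E * a0 + s%:E * a1 = a + J)%E ->
  ((1 - s)%:E * b0 + s%:E * b1 = b + J)%E ->
  (a - b <= ((1 - s)%:E * (a0 - b0) + s%:E * (a1 - b1))%dE)%E.
Proof.
move=> /andP[s0 s1]; have os0 : 0 < 1 - s by rewrite subr_gt0.
case: b => [b||] // a0fin a1fin afin Jfin b_ge0 aE bE; last first.
  by rewrite addeNy leNye.
have : ((1 - s)%:E * b0 + s%:E * b1)%E \is a fin_num.
  by rewrite bE fin_numD Jfin.
have fin_of_scale c (e : \bar R) : 0 < c -> (c%:E * e)%E \is a fin_num ->
    e \is a fin_num.
  by case: e => // c0; rewrite ?gt0_muley ?gt0_muleNy// lte_fin.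
rewrite fin_numD => /andP[/(fin_of_scale _ _ os0) b0fin].
move=> /(fin_of_scale _ _ s0) b1fin {b_ge0 fin_of_scale}.
case: a0 a0fin aE => // a0 _; case: a1 a1fin => // a1 _.
case: a afin => // a _; case: J Jfin bE => // J _.
case: b0 b0fin => // b0 _; case: b1 b1fin => // b1 _.
rewrite -!EFinM -!EFinD => -[bE] [aE].
rewrite -DualAddTheoryNumDomain.dEFinD lee_fin; lra.
Qed.

Theorem proposition4p7 (R : realType) (d : measure_display)
    (X : measurableType d) :
  NNCC_space (fun mu nu : probability X R => KL mu nu).
Proof.
move=> mu0 mu1 nu fin0 fin1.
(* The values at 0 and 1 are prescribed separately: mixtures with weights 0 and
   1 agree with the endpoints on measurable sets only, whereas the path has to
   take the endpoints themselves as values. *)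
have /choice[x xP] : forall s : R, exists m : probability X R,
    [/\ s = 0 -> m = mu0, s = 1 -> m = mu1 &
        0 < s < 1 -> is_mixture s mu0 mu1 m].
  move=> s; have [->|s0] := eqVneq s 0.
    by exists mu0; split=> // [/esym/eqP|]; rewrite ?oner_eq0 ?ltxx.
  have [->|s1] := eqVneq s 1.
    by exists mu1; split=> // [/eqP|]; rewrite ?oner_eq0 ?ltxx ?andbF.
  have [s01|s01] := boolP (0 < s < 1).
    have [m mE] := mixture_exists mu0 mu1 s s01.
    by exists m; split=> // /eqP; rewrite ?(negbTE s0) ?(negbTE s1).
  by exists mu0; split=> // /eqP; rewrite (negbTE s1).
have [x0 _ _] := xP 0; have [_ x1 _] := xP 1.
exists x; split; [|exact: x0|exact: x1].
(* The compensation identity with reference measure nu, whose left-hand side is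
   finite by assumption. *)
have fin_mix s : 0 < s < 1 ->
    KL (x s) nu \is a fin_num /\
    ((1 - s)%:E * KL mu0 (x s) + s%:E * KL mu1 (x s))%E \is a fin_num.
  move=> s01; have [_ _ /(_ s01) mE] := xP s.
  by apply/andP; rewrite -fin_numD -compensation_identity// fin_numD !fin_numM.
split.
  move=> s; rewrite !le_eqVlt => /andP[/predU1P[<-|s0] /predU1P[s1|s1]].
  - by rewrite x0.
  - by rewrite x0.
  - by rewrite s1 x1.
  - by have [] := fin_mix s; rewrite ?s0.
move=> s sigma s01; rewrite x0// x1//.
have [_ _ /(_ s01) mE] := xP s.
have [finx finJ] := fin_mix _ s01.
have := compensation_identity _ s01 _ _ _ mE nu.
have := compensation_identity _ s01 _ _ _ mE sigma.
move=> Es En; apply: (interpolation_of_equal_defects s01 _ _ _ _ _ En Es) => //.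
exact: KL_ge0.
Qed.
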